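(* Suppose that $P$ is a regular, reductive c-ramified $m\times n$ matrix over the faithful group representation $(X;G)$ and $P'$ is a regular c-ramified matrix over the faithful group representation $(X';G')$. Then the following are equivalent. 1. $L((X;G);P)$ is isomorphic to $L((X';G');P')$. 2. $(V_{\theta_P};L((X;G);P))$ is equivalent to $(V_{\theta_{P'}};L((X';G');P'))$. 3. There exist an $m\times m$ permutational matrix $A$ over $G$, an $n\times n$ permutational matrix $B$ over $G$, and an equivalence $\beta:(X;G)\to(X';G')$ such that $P'=\beta(APB)$.
   Context: All sets and semigroups are finite. A group representation $(X;G)$ is a group $G$ acting on the set $X$ by permutations (via a homomorphism $G\to S_X$); it is faithful if the homomorphism is injective. More generally a representation $(Y;U)$ of a subset $U$ of a semigroup is a map $u\mapsto(y\mapsto u(y))$ from $U$ to transformations of $Y$ preserving those products that lie in $U$. Two representations $(Y;U)$, $(Z;W)$ are equivalent if there is an equivalence between them: bijections $\beta:Y\to Z$ and $\beta:U\to W$ with $\beta(u(y))=\beta(u)(\beta(y))$ for all $u\in U,y\in Y$, and $\beta(uv)=\beta(u)\beta(v)$ whenever $u,v,uv\in U$. A c-ramified $m\times n$ matrix $P$ over $(X;G)$ has entries $P(\lambda,i)\in X\cup G$ (disjoint union), $\lambda\in\Lambda=\{1,\dots,m\}$, $i\in I=\{1,\dots,n\}$; entries are viewed as functions on $X$ (elements of $X$ as constant functions, elements of $G$ as permutations), products of entries are compositions: $g\cdot x=g(x)$ and $x\cdot g=x$ for $g\in G$, $x\in X$. With the convention that $0$ is absorbing for products and neutral for sums, the matrix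 products below make sense. $P$ is regular if every row and every column contains an entry from $G$. Distinct rows $\alpha,\beta$ are proportional if there is $g\in G$ with $gP(\alpha,i)=P(\beta,i)$ for all $i$; distinct columns $r,s$ are proportional if there is $h\in G$ with $P(\lambda,r)h=P(\lambda,s)$ for all $\lambda$. $P$ is reductive if it has no distinct proportional rows and no distinct proportional columns. $J((X;G);P)$ is the set of $n\times m$ matrices with exactly one non-zero entry, that entry in $G$; $[r,g,\lambda]$ has entry $g$ in position $(r,\lambda)$. $V$ is the set of $n$-vectors $i_x$ with exactly one non-zero entry $x\in X$, in row $i$. $J((X;G);P)$ acts on $V$ by $M(v)=MPv$, i.e. $[r,g,\lambda](i_x)=r_{gP(\lambda,i)(x)}$. Put $\theta_P=\{(r_x,s_y)\in V^2: P(\lambda,r)(x)=P(\lambda,s)(y)\ \forall\lambda\in\Lambda\}$ and $V_{\theta_P}=V/\theta_P$; the action descends to $V_{\theta_P}$. $L((X;G);P)$ is the semigroup consisting of $J((X;G);P)$ together with the constant transformations of $V_{\theta_P}$ (identified with elements of $V_{\theta_P}$), acting on $V_{\theta_P}$; explicitly, for $M,N\in J((X;G);P)$ the product is $MPN$ if its unique non-zero entry lies in $G$, and is the constant $i_x/\theta_P$ if that entry is $x\in X$ located in row $i$; for $v\in V_{\theta_P}$ the product $Mv$ is the constant $M(v)$, and $vs=v$ for every $s\in L((X;G);P)$. A $k\times k$ permutational matrix over $G$ has entries in $G\cup\{0\}$ with exactly one non-zero entry in each row and each column. For an equivalence $\beta:(X;G)\to(X';G')$ and a c-ramified matrix $Q$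 over $(X;G)$, $\beta(Q)$ is the matrix with entries $\beta(Q(\lambda,i))$. *)

(* Defs.v *)
From HB Require Import structures.
From mathcomp Require Import all_boot all_fingroup all_algebra.

Set Implicit Arguments.
Unset Strict Implicit.
Unset Printing Implicit Defensive.

Local Open Scope group_scope.
Local Open Scope quotient_scope.

(* Actions are on the left, u (v y) = (u v) y, unlike those of action.v. *)
Record semigroupRep := SemigroupRep {
  rep_pt : Type;
  rep_sg : semigroupType;
  rep_act : rep_sg -> rep_pt -> rep_pt;
  rep_actM : forall u v y, rep_act (u * v) y = rep_act u (rep_act v y)
}.

Record groupRep := GroupRep {
  gpt : finType;
  ggrp : finGroupType;
  gact : ggrp -> gpt -> gpt;
  gact1 : forall x, gact 1 x = x;
  gactM : forall g h x, gact (g * h) x = gact g (gact h x)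
}.

Definition semigroupRep_of_groupRep (R : groupRep) : semigroupRep :=
  @SemigroupRep (gpt R) (ggrp R) (@gact R) (@gactM R).
Coercion semigroupRep_of_groupRep : groupRep >-> semigroupRep.

Definition faithful_rep (R : groupRep) : Prop :=
  forall g h : ggrp R, (forall x, gact g x = gact h x) -> g = h.

Record repEquiv (R S : semigroupRep) := RepEquiv {
  equiv_pt : rep_pt R -> rep_pt S;
  equiv_sg : rep_sg R -> rep_sg S;
  equiv_pt_bij : bijective equiv_pt;
  equiv_sg_bij : bijective equiv_sg;
  equiv_act : forall u y,
    equiv_pt (rep_act u y) = rep_act (equiv_sg u) (equiv_pt y);
  equiv_mul : forall u v, equiv_sg (u * v) = equiv_sg u * equiv_sg v
}.

Definition rep_equivalent (R S : semigroupRep) : Prop :=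
  inhabited (repEquiv R S).

Definition semigroup_isomorphic (S T : semigroupType) : Prop :=
  exists2 phi : S -> T, bijective phi & {morph phi : s t / s * t}.

Section Entries.
Variable R : groupRep.

Definition entry : Type := (gpt R + ggrp R)%type.

Definition entry_fun (e : entry) (y : gpt R) : gpt R :=
  match e with inl x => x | inr g => gact g y end.

Definition entry_mul (e f : entry) : entry :=
  match e, f with
  | inl x, _ => inl x
  | inr g, inl x => inl (gact g x)
  | inr g, inr h => inr (g * h)
  end.

(* In option entry, None is the adjoined 0. *)
Definition entry0_mul (e f : option entry) : option entry :=
  match e, f with Some a, Some b => Some (entry_mul a b) | _, _ => None end.

(* The sum of two non-zero entries is left undefined in the mathematics: it
   never occurs in the products considered.  The value chosen here makes the
   operation associative with neutral element None. *)
Definition entry0_add (e f : option entry) : option entry :=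
  if e is Some a then Some a else f.

Lemma entry0_addA : associative entry0_add. Proof. by case. Qed.
Lemma entry0_add0 : left_id None entry0_add. Proof. by []. Qed.
Lemma entry0_addr0 : right_id None entry0_add. Proof. by case. Qed.

HB.instance Definition _ :=
  Monoid.isLaw.Build (option entry) None entry0_add
    entry0_addA entry0_add0 entry0_addr0.

Definition mx0_mul p q r (A : 'M[option entry]_(p, q))
    (B : 'M[option entry]_(q, r)) : 'M[option entry]_(p, r) :=
  \matrix_(i, j) \big[entry0_add/None]_k entry0_mul (A i k) (B k j).

Definition mx0_of_ramified p q (P : 'M[entry]_(p, q)) :
  'M[option entry]_(p, q) := map_mx Some P.

Definition mx0_of_group p q (A : 'M[option (ggrp R)]_(p, q)) :
  'M[option entry]_(p, q) := map_mx (omap inr) A.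

Definition permutational k (A : 'M[option (ggrp R)]_k) : Prop :=
  (forall i, exists! j, A i j <> None) /\ (forall j, exists! i, A i j <> None).

Lemma entry_fun_mul e f y :
  entry_fun (entry_mul e f) y = entry_fun e (entry_fun f y).
Proof. by case: e => [x|g]; case: f => [z|h] //=; rewrite gactM. Qed.

Lemma entry_mulA : associative entry_mul.
Proof.
by case=> [x|g] [y|h] [z|k] //=; rewrite ?gactM // mulgA.
Qed.

End Entries.
Arguments mx0_of_group {R p q} A.

Notation "A **m B" := (mx0_mul A B) (at level 40, left associativity).

Definition entry_map (R S : groupRep) (b : repEquiv R S) (e : entry R) :
    entry S :=
  match e with
  | inl x => inl (equiv_pt b x)
  | inr g => inr (equiv_sg b g)
  end.

Section Ramified.
Variables (R : groupRep) (m n : nat) (P : 'M[entry R]_(m, n)).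

Definition regular_mx : Prop :=
  (forall l, exists i, exists g : ggrp R, P l i = inr g) /\
  (forall i, exists l, exists g : ggrp R, P l i = inr g).

Definition proportional_rows (a b : 'I_m) : Prop :=
  exists g : ggrp R, forall i, entry_mul (inr g) (P a i) = P b i.

Definition proportional_cols (r s : 'I_n) : Prop :=
  exists h : ggrp R, forall l, entry_mul (P l r) (inr h) = P l s.

Definition reductive_mx : Prop :=
  (forall a b, a != b -> ~ proportional_rows a b) /\
  (forall r s, r != s -> ~ proportional_cols r s).

(* (r, g, l) stands for the n x m matrix [r, g, l], and (i, x) for the vector
   i_x; see Jmx, Vmx and the lemmas JmxP, VmxP, Jmx_mul, Jmx_act below. *)
Definition Jset : Type := ('I_n * ggrp R * 'I_m)%type.
Definition Vset : Type := ('I_n * gpt R)%type.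

Definition Jact (M : Jset) (v : Vset) : Vset :=
  let: (r, g, l) := M in let: (i, x) := v in
  (r, gact g (entry_fun (P l i) x)).

Definition theta : rel Vset :=
  fun u v => [forall l, entry_fun (P l u.1) u.2 == entry_fun (P l v.1) v.2].

Lemma theta_refl : reflexive theta.
Proof. by move=> u; apply/forallP. Qed.

Lemma theta_sym : symmetric theta.
Proof. by move=> u v; apply: eq_forallb => l; rewrite eq_sym. Qed.

Lemma theta_trans : transitive theta.
Proof.
move=> v u w /forallP uv /forallP vw; apply/forallP => l.
by rewrite (eqP (uv l)).
Qed.

Canonical theta_equiv := EquivRel theta theta_refl theta_sym theta_trans.

Definition Vtheta : Type := {eq_quot theta_equiv}.

Lemma theta_Jact M u v : theta u v -> Jact M u = Jact M v.
Proof.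
case: M u v => [[r g] l] [i x] [j y] /forallP/(_ l)/eqP /= E.
by rewrite E.
Qed.

Definition Jact_theta (M : Jset) (v : Vtheta) : Vtheta :=
  \pi_Vtheta (Jact M (generic_quotient.repr v)).

Arguments Jact_theta : simpl never.

Lemma Jact_theta_pi M v : Jact_theta M (\pi_Vtheta v) = \pi_Vtheta (Jact M v).
Proof.
rewrite /Jact_theta; congr (\pi_Vtheta _); apply: theta_Jact.
have: generic_quotient.repr (\pi_Vtheta v) == v %[mod Vtheta] by rewrite reprK.
by rewrite pi_eq_quot.
Qed.

Definition Lset : Type := (Jset + Vtheta)%type.
HB.instance Definition _ := Choice.on Lset.

(* The only non-zero entry of M P N is g P(l, s) h, in position (r, k). *)
Definition Jmul (M N : Jset) : Lset :=
  let: (r, g, l) := M in let: (s, h, k) := N in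
  match entry_mul (entry_mul (inr g) (P l s)) (inr h) with
  | inr f => inl (r, f, k)
  | inl x => inr (\pi_Vtheta (r, x))
  end.

Definition Lmul (s t : Lset) : Lset :=
  match s, t with
  | inl M, inl N => Jmul M N
  | inl M, inr v => inr (Jact_theta M v)
  | inr v, _ => inr v
  end.

Definition Lact (s : Lset) (v : Vtheta) : Vtheta :=
  match s with inl M => Jact_theta M v | inr c => c end.

Lemma LactM s t v : Lact (Lmul s t) v = Lact s (Lact t v).
Proof.
case: s t => [[[r g] l]|c] [[[s h] k]|d] //.
elim/quotW: v => -[i x] /=.
rewrite (Jact_theta_pi (s, h, k) (i, x)) Jact_theta_pi /=.
case E: (P l s) => [y|f] //=; rewrite Jact_theta_pi /=.
by rewrite !gactM.
Qed.

Lemma LmulA : associative Lmul.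
Proof.
case=> [M|c] // [N|d] // [K|v]; last first.
  have := LactM (inl M) (inl N) v; rewrite /Lmul.
  by case: (Jmul M N) => [?|?] /= ->.
case: M N K => [[r g] l] [[s h] k] [[t f] j] /=.
case E: (P l s) => [y|e] /=; case F: (P k t) => [z|e'] /=;
  rewrite ?Jact_theta_pi /= ?E ?F //=.
- by rewrite !gactM.
- by rewrite !mulgA.
Qed.

HB.instance Definition _ := isSemigroup.Build Lset LmulA.

Definition Lsemigroup : semigroupType := Lset.

Definition Lrep : semigroupRep := @SemigroupRep Vtheta Lsemigroup Lact LactM.

Definition Jmx (M : Jset) : 'M[option (ggrp R)]_(n, m) :=
  \matrix_(i, k) if (i == M.1.1) && (k == M.2) then Some M.1.2 else None.

Definition Vmx (v : Vset) : 'cV[option (entry R)]_n :=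
  \col_i if i == v.1 then Some (inl v.2) else None.

Lemma JmxP (A : 'M[option (ggrp R)]_(n, m)) :
  (exists! p, A p.1 p.2 <> None) <-> (exists M, A = Jmx M).
Proof.
split=> [[[i k] /= [Aik Au]]|[[[r g] l] ->]].
  case E: (A i k) Aik => [g|] // _; exists (i, g, k).
  apply/matrixP => j l; rewrite !mxE /=.
  have [/andP[/eqP-> /eqP->] //|] := boolP ((j == i) && (l == k)).
  case F: (A j l) => [h|] //; have := Au (j, l).
  by rewrite /= F => /(_ ltac:(done)) [<- <-]; rewrite !eqxx.
exists (r, l); split=> [|[i k]]; rewrite !mxE /= ?eqxx //.
by case: andP => // -[/eqP-> /eqP->].
Qed.

Lemma VmxP (v : 'cV[option (entry R)]_n) :
  (exists i x, v i ord0 = Some (inl x) /\ forall j, j != i -> v j ord0 = None)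
  <-> (exists u, v = Vmx u).
Proof.
split=> [[i [x [vi vj]]]|[[i x] ->]].
  exists (i, x); apply/matrixP => j k; rewrite ord1 !mxE /=.
  by case: eqVneq => [->|/vj].
exists i, x; rewrite !mxE eqxx; split=> // j /negPf ji.
by rewrite !mxE ji.
Qed.

Lemma big_entry0_only k (i : 'I_k) (F : 'I_k -> option (entry R)) :
  (forall j, j != i -> F j = None) -> \big[@entry0_add R/None]_j F j = F i.
Proof.
move=> F0; rewrite (eq_bigr (fun j => if j == i then F i else None)).
  rewrite -big_mkcond /= -big_filter filter_pred1_uniq ?index_enum_uniq //.
    by rewrite big_seq1.
  by rewrite mem_index_enum.
by move=> j _; case: eqVneq => [->|/F0].
Qed.

Lemma Jmx_act M v :
  mx0_of_group (Jmx M) **m mx0_of_ramified P **m Vmx v = Vmx (Jact M v).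
Proof.
case: M v => [[r g] l] [i x]; apply/matrixP => j k; rewrite !mxE /=.
rewrite (big_entry0_only (i := i)) => [|i' /negPf ne]; rewrite !mxE /=.
  rewrite eqxx (big_entry0_only (i := l)) => [|l' /negPf ne]; rewrite !mxE /=.
    by rewrite eqxx andbT; case: (j == r) => //; case: (P l i) => //= h; rewrite gactM.
  by rewrite ne andbF.
by rewrite ne; case: (bigop _ _ _).
Qed.

Lemma Jmx_mul M N :
  mx0_of_group (Jmx M) **m mx0_of_ramified P **m mx0_of_group (Jmx N) =
  (\matrix_(i, k) if (i == M.1.1) && (k == N.2)
    then Some (entry_mul (entry_mul (inr M.1.2) (P M.2 N.1.1)) (inr N.1.2))
    else None)%R.
Proof.
case: M N => [[r g] l] [[s h] k]; apply/matrixP => i j; rewrite !mxE /=.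
rewrite (big_entry0_only (i := s)) => [|i' /negPf ne]; rewrite !mxE /=.
  rewrite eqxx (big_entry0_only (i := l)) => [|l' /negPf ne]; rewrite !mxE /=.
    by rewrite eqxx andbT; case: (i == r) => //=; case: (j == k).
  by rewrite ne andbF.
by rewrite ne; case: (bigop _ _ _).
Qed.

End Ramified.

(* Main.v *)
(* An isomorphism phi from L(P) to L(P') maps J to J' and constants to constants,
   so by regularity it permutes the row and column indices by rho and sigma.
   Fixing a group entry g0 = P(l0, i0), the Rees-matrix argument gives
   phi [r, g, l] = [rho r, U_r gamma(g) V_l, sigma l] with gamma an isomorphism,
   and the action of [r, g, l0] on the points (i0)_x then gives
   phi (r_x) = (rho r)_(U_r delta(x)) with delta equivariant along gamma.
   Comparing products, V_l P'(sigma l, rho i) U_i is the image of P(l, i) under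
   (delta, gamma); the same formulas turn such an identity into an isomorphism. *)
From mathcomp Require Import all_boot all_fingroup all_algebra.
Require Import Defs.

Set Implicit Arguments.
Unset Strict Implicit.
Unset Printing Implicit Defensive.

Local Open Scope group_scope.
Local Open Scope quotient_scope.

(** Preimages are selected by [xchoose], so the inverse needs no choice axiom; decidable equality on
    [U] makes being a preimage a boolean predicate. *)
Lemma inj_surj_bij (T : choiceType) (U : eqType) (f : T -> U) :
  injective f -> (forall y, exists x, f x = y) -> bijective f.
Proof.
move=> f_inj f_surj.
have f_surjb y : exists x, f x == y by have [x <-] := f_surj y; exists x.
exists (fun y => xchoose (f_surjb y)) => [x|y]; last exact/eqP/(xchooseP (f_surjb y)).
exact/f_inj/eqP/(xchooseP (f_surjb (f x))).
Qed.

(** * Products in [J] over a regular matrix *)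

Section Products.
Variables (R : groupRep) (m n : nat) (P : 'M[entry R]_(m, n)).

Lemma Jmul_inl_coord M N K :
  Jmul P M N = inl K -> K.1.1 = M.1.1 /\ K.2 = N.2.
Proof. by case: M N => [[r g] l] [[s h] k] /=; case: (P l s) => //= f [<-]. Qed.

Lemma Jmul_inrE r g l s h k f : P l s = inr f ->
  Jmul P (r, g, l) (s, h, k) = inl (r, g * f * h, k).
Proof. by rewrite /= => ->. Qed.

Lemma Jmul_inlE r g l s h k x : P l s = inl x ->
  Jmul P (r, g, l) (s, h, k) = inr (\pi_(Vtheta P) (r, gact g x)).
Proof. by rewrite /= => ->. Qed.

Hypothesis regP : regular_mx P.

(** A group entry [f] in row [l] can be cancelled. Thus all elements with a given first index
    generate the same right ideal, which is why an isomorphism respects that index. *)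
Lemma regular_right_div r g l h k :
  exists N, Jmul P (r, g, l) N = inl (r, h, k).
Proof.
have [i [f Pf]] := regP.1 l; exists (i, f^-1 * g^-1 * h, k).
by rewrite (Jmul_inrE _ _ _ _ Pf) !mulgA mulgK mulgV mul1g.
Qed.

Lemma regular_left_div s g l r h :
  exists N, Jmul P N (s, g, l) = inl (r, h, l).
Proof.
have [k [f Pf]] := regP.2 s; exists (r, h * g^-1 * f^-1, k).
by rewrite (Jmul_inrE _ _ _ _ Pf) mulgKV mulgKV.
Qed.

Lemma regular_simple M N : exists K L, Lmul (Lmul (inl K) (inl M)) (inl L) = inl N :> Lset P.
Proof.
case: M N => [[s g] l] [[r h] k].
have [K KM] := regular_left_div s g l r h.
have [L ML] := regular_right_div r h l h k.
exists K, L; exact: etrans (congr1 (fun s => Lmul s (inl L)) KM) ML.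
Qed.

(** A group entry in column [i] acts injectively, so one coordinate already separates the points of
    row [i]. This lets equations between constants be read off in the underlying set. *)
Lemma pi_theta_inj i : injective (fun x => \pi_(Vtheta P) (i, x)).
Proof.
move=> x y /eqP; rewrite eqmodE /= => /forallP th.
have [l [g Pg]] := regP.2 i; move/eqP: (th l); rewrite /= Pg /=.
by move/(congr1 (gact g^-1)); rewrite -!gactM mulVg !gact1.
Qed.

End Products.

(** * Equivalences of group representations *)

Section EquivGroup.
Variables (R R' : groupRep) (beta : repEquiv R R').

Definition equiv_grp : ggrp R -> ggrp R' := equiv_sg beta.
Definition equiv_set : gpt R -> gpt R' := equiv_pt beta.

Lemma equiv_grpM : {morph equiv_grp : g h / g * h}.
Proof. by move=> g h; exact: (equiv_mul beta g h). Qed.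

Lemma equiv_grp1 : equiv_grp 1 = 1.
Proof. by apply: (mulgI (equiv_grp 1)); rewrite -equiv_grpM !mulg1. Qed.

Lemma equiv_grpV g : equiv_grp g^-1 = (equiv_grp g)^-1.
Proof. by apply: (mulgI (equiv_grp g)); rewrite -equiv_grpM !mulgV equiv_grp1. Qed.

Lemma equiv_setE g x : equiv_set (gact g x) = gact (equiv_grp g) (equiv_set x).
Proof. exact: (equiv_act beta g x). Qed.

Lemma equiv_grp_bij : bijective equiv_grp. Proof. exact: (equiv_sg_bij beta). Qed.
Lemma equiv_set_bij : bijective equiv_set. Proof. exact: (equiv_pt_bij beta). Qed.

Lemma entry_map_mul e f :
  entry_map beta (entry_mul e f) = entry_mul (entry_map beta e) (entry_map beta f).
Proof.
case: e f => [x|g] [y|h] //.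
  exact: (congr1 (@inl _ (ggrp R')) (equiv_setE g y)).
exact: (congr1 (@inr (gpt R') _) (equiv_grpM g h)).
Qed.

Lemma entry_map_fun e x :
  entry_fun (entry_map beta e) (equiv_set x) = equiv_set (entry_fun e x).
Proof. by case: e => [y|g] //=; rewrite equiv_setE. Qed.

End EquivGroup.

(** * From an identity between matrices to an isomorphism *)

Section MatrixEquiv.
Variables (R R' : groupRep) (m n m' n' : nat).
Variables (P : 'M[entry R]_(m, n)) (P' : 'M[entry R']_(m', n')).

Definition matrix_equiv : Prop :=
  exists (beta : repEquiv R R') (sigma : 'I_m -> 'I_m') (rho : 'I_n -> 'I_n')
         (V : 'I_m -> ggrp R') (U : 'I_n -> ggrp R'),
    [/\ bijective sigma, bijective rho &
        forall l i, entry_mul (entry_mul (inr (V l)) (P' (sigma l) (rho i))) (inr (U i))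
                    = entry_map beta (P l i)].

Lemma matrix_equiv_iso :
  matrix_equiv -> semigroup_isomorphic (Lsemigroup P) (Lsemigroup P').
Proof.
case=> beta [sigma [rho [V [U [[sigmai sK sK'] [rhoi rK rK'] PE]]]]].
pose fV (v : Vset R n) : Vset R' n' := (rho v.1, gact (U v.1) (equiv_set beta v.2)).
pose fJ (M : Jset R m n) : Jset R' m' n' :=
  (rho M.1.1, U M.1.1 * equiv_grp beta M.1.2 * V M.2, sigma M.2).
have fVE l v : gact (V l) (entry_fun (P' (sigma l) (fV v).1) (fV v).2) =
    equiv_set beta (entry_fun (P l v.1) v.2).
  by rewrite -entry_map_fun -PE !entry_fun_mul.
have act_inj g : injective (@gact R' g).
  by move=> x y /(congr1 (gact g^-1)); rewrite -!gactM mulVg !gact1.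
(* Each [V l] acts injectively and [sigma] is onto, so agreement in all coordinates for [P'] and for
   [P] amount to the same. *)
have fV_theta u v : theta P' (fV u) (fV v) = theta P u v.
  apply/forallP/forallP => uv l; apply/eqP.
    by apply: (bij_inj (equiv_set_bij beta)); rewrite -!fVE (eqP (uv (sigma l))).
  by rewrite -(sK' l); apply: (act_inj (V (sigmai l))); rewrite !fVE (eqP (uv (sigmai l))).
pose fQ (c : Vtheta P) : Vtheta P' := \pi_(Vtheta P') (fV (generic_quotient.repr c)).
have fQE v : fQ (\pi_(Vtheta P) v) = \pi_(Vtheta P') (fV v).
  apply/eqP; rewrite eqmodE /= fV_theta.
  have: generic_quotient.repr (\pi_(Vtheta P) v) == v %[mod Vtheta P] by rewrite reprK.
  by rewrite eqmodE.
pose f (s : Lset P) : Lset P' :=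
  match s with inl M => inl (fJ M) | inr c => inr (fQ c) end.
have fQact M c : fQ (Jact_theta M c) = Jact_theta (fJ M) (fQ c).
  case: M => [[r g] l]; elim/quotW: c => -[i x].
  rewrite Jact_theta_pi !fQE Jact_theta_pi /=.
  by congr (\pi_(Vtheta P') (_, _)); rewrite /= !gactM equiv_setE (fVE l (i, x)).
exists f; last first.
  case=> [[[r g] l]|c] // [[[s h] k]|d] //; last first.
    exact: (congr1 (@inr _ (Vtheta P')) (fQact (r, g, l) d)).
  (* [PE] forces the two entries to be both points or both group elements; the mixed cases are
     constructor clashes. *)
  have := PE l s; case E: (P l s) => [x|e]; case E': (P' (sigma l) (rho s)) => [y|e'] // -[PE1].
    rewrite [_ * _](Jmul_inlE r g h k E) [_ * _ in RHS](Jmul_inlE _ _ _ _ E').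
    by congr inr; rewrite fQE /fV /= equiv_setE !gactM PE1.
  rewrite [_ * _](Jmul_inrE r g h k E) [_ * _ in RHS](Jmul_inrE _ _ _ _ E').
  by congr inl; rewrite /fJ /= !equiv_grpM /equiv_grp -PE1 !mulgA.
apply: inj_surj_bij.
  move=> [[[r g] l]|c] [[[s h] k]|d] // [].
    move=> /(can_inj rK) <- gh /(can_inj sK) lk; rewrite -lk in gh *.
    by move/mulIg/mulgI/(bij_inj (equiv_grp_bij beta)): gh => ->.
  elim/quotW: c; elim/quotW: d => u v; rewrite !fQE => /eqP.
  by rewrite eqmodE /= fV_theta => th; congr inr; apply/eqP; rewrite eqmodE.
have [gi gK gK'] := equiv_grp_bij beta.
have [xi xK xK'] := equiv_set_bij beta.
case=> [[[r g] l]|c].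
  exists (inl (rhoi r, gi ((U (rhoi r))^-1 * g * (V (sigmai l))^-1), sigmai l)).
  by rewrite /f /fJ /= gK' rK' sK' !mulgA mulgKV mulgV mul1g.
elim/quotW: c => -[i x].
exists (inr (\pi_(Vtheta P) (rhoi i, xi (gact (U (rhoi i))^-1 x)))).
by rewrite /f fQE /fV /= xK' -gactM mulgV gact1 rK'.
Qed.

End MatrixEquiv.

(** * Permutational matrices as a permutation with group weights *)

Section Permutational.
Variable R : groupRep.

Definition monomial_mx k (s : 'I_k -> 'I_k) (a : 'I_k -> ggrp R) :
  'M[option (ggrp R)]_k := \matrix_(i, j) if j == s i then Some (a i) else None.

Lemma permutational_tr k (A : 'M[option (ggrp R)]_k) :
  permutational A -> permutational (trmx A).
Proof.
case=> rowA colA; split=> i; [have [j [? ju]] := colA i|have [j [? ju]] := rowA i];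
  by exists j; split=> [|j']; rewrite mxE // => /ju.
Qed.

Lemma monomial_permutational k (s : 'I_k -> 'I_k) a :
  bijective s -> permutational (monomial_mx s a).
Proof.
case=> t sK tK; split=> i.
  by exists (s i); split=> [|j]; rewrite mxE ?eqxx //; case: eqVneq.
exists (t i); split=> [|j]; rewrite mxE ?tK ?eqxx //.
by case: eqVneq => // ->; rewrite sK.
Qed.

Lemma permutational_monomial k (A : 'M[option (ggrp R)]_k) :
  permutational A -> exists s a, bijective s /\ A = monomial_mx s a.
Proof.
case=> rowA colA.
have /fin_all_exists2[s sA sU] i :
    exists2 j, A i j <> None & forall j', A i j' <> None -> j = j'.
  by have [j []] := rowA i; exists j.
(* The default [1] is never reached, since [A i (s i)] is non-zero. *)
exists s, (fun i => odflt 1 (A i (s i))); split.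
  apply: injF_bij => i j sij; have [l [_ lU]] := colA (s i).
  by rewrite -(lU i (sA i)) -(lU j) // sij.
apply/matrixP => i j; rewrite mxE; case: eqVneq => [->|ne].
  by case E: (A i (s i)) (sA i).
case E: (A i j) => [g|] //; have := sU i j; rewrite E => /(_ ltac:(done)) sij.
by rewrite sij eqxx in ne.
Qed.

(** The right factor is transposed so that [t] and [b] are indexed by the columns of the product:
    column [i] has its only non-zero entry [b i] in row [t i]. Each sum then has a single non-zero
    term. *)
Lemma mx0_mul_monomial m n (P : 'M[entry R]_(m, n)) s a t b :
  mx0_of_group (monomial_mx s a) **m mx0_of_ramified P
    **m mx0_of_group (trmx (monomial_mx t b)) =
  mx0_of_ramified
    (\matrix_(l, i) entry_mul (entry_mul (inr (a l)) (P (s l) (t i))) (inr (b i))).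
Proof.
apply/matrixP => l i; rewrite !mxE (big_entry0_only (i := t i)) => [|j /negPf ne].
  rewrite !mxE eqxx (big_entry0_only (i := s l)) => [|j /negPf ne]; rewrite !mxE ?eqxx //.
  by rewrite ne.
by rewrite !mxE ne; case: (bigop _ _ _).
Qed.

End Permutational.

Lemma matrix_equivP (R R' : groupRep) m n (P : 'M[entry R]_(m, n)) (P' : 'M[entry R']_(m, n)) :
  matrix_equiv P P' <->
  exists (A : 'M[option (ggrp R)]_m) (B : 'M[option (ggrp R)]_n) (beta : repEquiv R R'),
    [/\ permutational A, permutational B &
        mx0_of_ramified P' = map_mx (omap (entry_map beta))
          (mx0_of_group A **m mx0_of_ramified P **m mx0_of_group B)].
Proof.
have mulgx (S : groupRep) (g h : ggrp S) e :
    entry_mul (entry_mul (inr g^-1) (entry_mul (entry_mul (inr g) e) (inr h))) (inr h^-1) = e.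
  case: e => [x|f] /=; first by rewrite -gactM mulVg gact1.
  by rewrite !mulgA mulVg mul1g mulgK.
split=> [|[A [B [beta [permA permB P'E]]]]].
  case=> beta [sigma [rho [V [U [[s sK sK'] [t tK tK'] PE]]]]].
  have [gi gK gK'] := equiv_grp_bij beta.
  (* These weights come from solving [PE] for the entry of [P'] at [(l, i)], with the row and column
     indices pulled back by [s] and [t]. *)
  exists (monomial_mx s (fun l => gi (V (s l))^-1)).
  exists (trmx (monomial_mx t (fun i => gi (U (t i))^-1))), beta; split.
  - by apply: monomial_permutational; exists sigma.
  - by apply/permutational_tr/monomial_permutational; exists rho.
  apply/matrixP => l i; rewrite mx0_mul_monomial !mxE; apply: (congr1 Some).
  by rewrite !entry_map_mul -PE !sK' !tK' /= -!/(equiv_grp _ _) !gK' mulgx.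
have [s [a [[si sK sK'] AE]]] := permutational_monomial permA.
have [t [b [[ti tK tK'] BE]]] := permutational_monomial (permutational_tr permB).
exists beta, si, ti, (fun l => equiv_grp beta (a (si l))^-1), (fun i => equiv_grp beta (b (ti i))^-1).
split; [by exists s|by exists t|move=> l i].
have {P'E} ->: P' (si l) (ti i) = entry_map beta
    (entry_mul (entry_mul (inr (a (si l))) (P l i)) (inr (b (ti i)))).
  move/matrixP/(_ (si l) (ti i)): P'E; rewrite AE -[B]trmxK BE mx0_mul_monomial !mxE.
  by rewrite sK' tK' => /Some_inj.
by rewrite !entry_map_mul !equiv_grpV; apply: (@mulgx R').
Qed.

(** * Index coordinates of an isomorphism *)

Section IsoPreserves.
Variables (R R' : groupRep) (m n m' n' : nat).
Variables (P : 'M[entry R]_(m, n)) (P' : 'M[entry R']_(m', n')).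
Variables (phi : Lset P -> Lset P') (psi : Lset P' -> Lset P).
Hypotheses (phiK : cancel phi psi) (psiK : cancel psi phi).
Hypothesis phiM : forall s t, phi (Lmul s t) = Lmul (phi s) (phi t).
Hypothesis (regP : regular_mx P).
Hypotheses (m'_gt0 : (0 < m')%N) (n'_gt0 : (0 < n')%N).

(* If phi sent [M] to a constant, the preimage of the ideal of constants would
   be an ideal containing all of J, hence, as c = c M, every constant c. *)
Lemma iso_inl M : exists M', phi (inl M) = inl M'.
Proof.
case E: (phi (inl M)) => [M'|v]; first by exists M'.
have all_inr s : exists c, phi s = inr c.
  case: s => [N|c].
    have [K [L <-]] := regular_simple regP M N.
    rewrite 2!phiM E; case: (phi (inl K)) => [K'|c]; last by exists c.
    by exists (Jact_theta K' v).
  have ->: phi (inr c) = Lmul (phi (inr c)) (inr v) by rewrite -E -phiM.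
  by case: (phi _) => [K'|d]; [exists (Jact_theta K' v)|exists d].
(* As [m'] and [n'] are positive, [P'] has an element of [J]; being in the image of [phi], it would
   be a constant. *)
have [c] := all_inr (psi (inl (Ordinal n'_gt0, 1, Ordinal m'_gt0))).
by rewrite psiK.
Qed.

End IsoPreserves.

(** The same [rho] serves for elements of [J] and for constants, while [f] and [D] may still depend
    on all their arguments. *)
Definition iso_coordinates (R R' : groupRep) m n m' n'
    (P : 'M[entry R]_(m, n)) (P' : 'M[entry R']_(m', n'))
    (phi : Lset P -> Lset P') rho sigma f D : Prop :=
  (forall r g l, phi (inl (r, g, l)) = inl (rho r, f r g l, sigma l)) /\
  (forall r x, phi (inr (\pi_(Vtheta P) (r, x))) = inr (\pi_(Vtheta P') (rho r, D r x))).

Lemma iso_coordinatesP (R R' : groupRep) m n m' n'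
    (P : 'M[entry R]_(m, n)) (P' : 'M[entry R']_(m', n'))
    (phi : Lset P -> Lset P') (psi : Lset P' -> Lset P) :
  cancel phi psi -> cancel psi phi ->
  (forall s t, phi (Lmul s t) = Lmul (phi s) (phi t)) ->
  regular_mx P -> regular_mx P' ->
  (0 < m)%N -> (0 < n)%N -> (0 < m')%N -> (0 < n')%N ->
  exists rho sigma f D, iso_coordinates phi rho sigma f D.
Proof.
move=> phiK psiK phiM regP regP' m_gt0 n_gt0 m'_gt0 n'_gt0.
have psiM s t : psi (Lmul s t) = Lmul (psi s) (psi t).
  by rewrite -{1}(psiK s) -{1}(psiK t) -phiM phiK.
have phi_inl M := iso_inl psiK phiM regP m'_gt0 n'_gt0 M.
have phi_inr c : exists c', phi (inr c) = inr c'.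
  case E: (phi (inr c)) => [M'|c']; last by exists c'.
  have [M] := iso_inl phiK psiM regP' m_gt0 n_gt0 M'.
  by rewrite -E phiK.
have /fin_all_exists[fJ fJE] M : exists M', phi (inl M) = inl M' by apply: phi_inl.
have fJM M N K : Jmul P M N = inl K -> Jmul P' (fJ M) (fJ N) = inl (fJ K).
  by move=> MN; rewrite -[inl (fJ K)]fJE -MN -[Jmul P M N]/(Lmul (inl M) (inl N)) phiM !fJE.
pose i0 := Ordinal n_gt0; pose l0 := Ordinal m_gt0.
pose rho r := (fJ (r, 1, l0)).1.1; pose sigma l := (fJ (i0, 1, l)).2.
have fJrho r g l : (fJ (r, g, l)).1.1 = rho r.
  by have [N /fJM/Jmul_inl_coord[-> _]] := regular_right_div regP r 1 l0 g l.
have fJsigma r g l : (fJ (r, g, l)).2 = sigma l.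
  by have [N /fJM/Jmul_inl_coord[_ ->]] := regular_left_div regP i0 1 l r g.
have /fin_all_exists[D DE] (u : Vset R n) : exists x',
    phi (inr (\pi_(Vtheta P) u)) = inr (\pi_(Vtheta P') (rho u.1, x')).
  case: u => r x; have [l [g Pg]] := regP.2 r.
  (* The constant is a left multiple of an element of [J] with first index [r], so its image lies in
     row [rho r]. *)
  have -> : inr (\pi_(Vtheta P) (r, x)) =
      Lmul (inl (r, g^-1, l)) (inr (\pi_(Vtheta P) (r, x))) :> Lset P.
    by rewrite /= Jact_theta_pi /= Pg /= -gactM mulVg gact1.
  rewrite phiM fJE; have [c' ->] := phi_inr (\pi_(Vtheta P) (r, x)).
  elim/quotW: c' => -[j y]; rewrite /= Jact_theta_pi -(fJrho r g^-1 l).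
  by case: (fJ _) => [[r' g'] l'] /=; eexists.
exists rho, sigma, (fun r g l => (fJ (r, g, l)).1.2), (fun r x => D (r, x)).
split=> [r g l|r x]; last by rewrite DE.
by rewrite fJE -(fJrho r g l) -(fJsigma r g l); case: (fJ _) => [[]].
Qed.

(** * The Rees-matrix argument: from an isomorphism to an identity between matrices *)

Lemma iso_matrix_equiv (R R' : groupRep) m n m' n'
    (P : 'M[entry R]_(m, n)) (P' : 'M[entry R']_(m', n')) :
  (0 < m)%N -> (0 < n)%N -> (0 < m')%N -> (0 < n')%N ->
  regular_mx P -> regular_mx P' ->
  semigroup_isomorphic (Lsemigroup P) (Lsemigroup P') -> matrix_equiv P P'.
Proof.
move=> m_gt0 n_gt0 m'_gt0 n'_gt0 regP regP' [phi [psi phiK psiK] phiM].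
have {}phiM (s t : Lset P) : phi (Lmul s t) = Lmul (phi s) (phi t) by apply: phiM.
have psiM s t : psi (Lmul s t) = Lmul (psi s) (psi t).
  by rewrite -{1}(psiK s) -{1}(psiK t) -phiM phiK.
have [rho [sigma [f [D [phiJ phiV]]]]] :=
  iso_coordinatesP phiK psiK phiM regP regP' m_gt0 n_gt0 m'_gt0 n'_gt0.
have [rhoi [sigmai [fi [Di [psiJ psiV]]]]] :=
  iso_coordinatesP psiK phiK psiM regP' regP m'_gt0 n'_gt0 m_gt0 n_gt0.
pose l0 := Ordinal m_gt0; have [i0 [g0 Pg0]] := regP.1 l0.
pose l1 := Ordinal m'_gt0; pose i1 := Ordinal n'_gt0.
have rhoK : cancel rho rhoi
  by move=> r; have := phiK (inl (r, 1, l0)); rewrite phiJ psiJ => -[].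
have sigmaK : cancel sigma sigmai
  by move=> l; have := phiK (inl (i0, 1, l)); rewrite phiJ psiJ => -[].
have rhoK' : cancel rhoi rho
  by move=> r; have := psiK (inl (r, 1, l1)); rewrite psiJ phiJ => -[].
have sigmaK' : cancel sigmai sigma
  by move=> l; have := psiK (inl (i1, 1, l)); rewrite psiJ phiJ => -[].
(* A product of two elements of [J] lies in [J] exactly when the entry between them is a group
   element, and [phi] keeps [J] apart from the constants. *)
have prodG l s g : P l s = inr g -> exists2 g', P' (sigma l) (rho s) = inr g' &
    forall r a b k, f r (a * g * b) k = f r a l * g' * f s b k.
  move=> Pg; have prod r a b k := phiM (inl (r, a, l)) (inl (s, b, k)).
  case Pg': (P' (sigma l) (rho s)) => [x'|g'].
    have := prod i0 1 1 l0; rewrite [Lmul _ _](Jmul_inrE _ _ _ _ Pg) !phiJ.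
    by rewrite [Lmul _ _ in RHS](Jmul_inlE _ _ _ _ Pg').
  exists g' => // r a b k; have := prod r a b k.
  by rewrite [Lmul _ _](Jmul_inrE _ _ _ _ Pg) !phiJ [Lmul _ _ in RHS](Jmul_inrE _ _ _ _ Pg') => -[].
have prodX l s x : P l s = inl x -> exists2 x', P' (sigma l) (rho s) = inl x' &
    forall r a, D r (gact a x) = gact (f r a l) x'.
  move=> Px; have prod r a := phiM (inl (r, a, l)) (inl (s, 1, l0)).
  case Px': (P' (sigma l) (rho s)) => [x'|g'].
    exists x' => // r a; have := prod r a.
    rewrite [Lmul _ _](Jmul_inlE _ _ _ _ Px) !phiJ phiV [Lmul _ _ in RHS](Jmul_inlE _ _ _ _ Px').
    by move=> [/(pi_theta_inj regP')].
  have := prod i0 1; rewrite [Lmul _ _](Jmul_inlE _ _ _ _ Px) !phiJ phiV.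
  by rewrite [Lmul _ _ in RHS](Jmul_inrE _ _ _ _ Px').
have [q Pq fM] := prodG l0 i0 g0 Pg0.
(* The elements [[i0, a, l0]] form a group isomorphic to [G] by sending [g] to [a = g0^-1 * g]. On
   the image side [b] goes to [b * q], and [gamma] is [phi] read through these two
   identifications. *)
pose gamma g := f i0 (g0^-1 * g) l0 * q.
pose U r := f r 1 l0 * q.
pose V l := gamma g0^-1 * f i0 1 l.
have gammaM : {morph gamma : g h / g * h}.
  by move=> g h; rewrite /gamma !mulgA -fM !mulgA mulgK.
have gamma1 : gamma 1 = 1 by apply: (mulgI (gamma 1)); rewrite -gammaM !mulg1.
(* Factor [[r, g, l]] as [[r, 1, l0] [i0, g0^-1 * g * g0^-1, l0] [i0, 1, l]] and apply [fM]
   twice. *)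
have fE r g l : f r g l = U r * gamma g * V l.
  have := fM r 1 (g0^-1 * g) l; rewrite mul1g mulKVg => ->.
  have := fM i0 (g0^-1 * g * g0^-1) 1 l; rewrite mulg1 mulgKV => ->.
  by rewrite /V (mulgA (U r * _)) -(mulgA (U r)) -gammaM /gamma !mulgA.
have gamma_bij : bijective gamma.
  apply: inj_surj_bij => [g h /mulIg E|g'].
    apply: (mulgI g0^-1); have := phiJ i0 (g0^-1 * h) l0.
    by rewrite -E -phiJ => /(can_inj phiK) [].
  have := psiJ (rho i0) (g' * q^-1) (sigma l0); rewrite rhoK sigmaK; set h := fi _ _ _ => E.
  exists (g0 * h); have := psiK (inl (rho i0, g' * q^-1, sigma l0)).
  by rewrite E phiJ /gamma mulKg => -[->]; rewrite mulgKV.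
have gammaP l s g g' : P l s = inr g -> P' (sigma l) (rho s) = inr g' ->
    gamma g = V l * g' * U s.
  move=> Pg Pg'; have [g''] := prodG l s g Pg; rewrite Pg' => -[<-] /(_ i0 1 1 l0).
  rewrite mul1g mulg1 !fE gamma1 !mulg1 => E.
  by apply: (mulgI (U i0)); apply: (mulIg (V l0)); rewrite E !mulgA.
pose delta x := gact (U i0)^-1 (D i0 x).
(* The element [[r, h * g0^-1, l0]] sends the point [x] of row [i0] to the point [h x] of row [r],
   because [P l0 i0] is [g0]. *)
have DE r h x : D r (gact h x) = gact (U r * gamma h) (delta x).
  have := phiM (inl (r, h * g0^-1, l0)) (inr (\pi_(Vtheta P) (i0, x))).
  rewrite phiJ phiV /= !Jact_theta_pi /= Pg0 Pq /= phiV -!gactM mulgKV.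
  move=> [/(pi_theta_inj regP') ->].
  have gammaV: gamma g0^-1 * V l0 * q = (U i0)^-1.
    apply: (mulIg (U i0)); rewrite mulVg -2!mulgA (mulgA (V l0)) -(gammaP _ _ _ _ Pg0 Pq).
    by rewrite -gammaM mulVg.
  by rewrite fE gammaM -gammaV !mulgA.
have D1 r x : D r x = gact (U r) (delta x) by rewrite -{1}(gact1 x) DE gamma1 mulg1.
have delta_bij : bijective delta.
  apply: inj_surj_bij => [x y E|x'].
    apply: (pi_theta_inj regP (i := i0)).
    have := phiV i0 x; rewrite D1 E -D1 -phiV => /(can_inj phiK) E'.
    by move: E' => [].
  have := psiV (rho i0) (gact (U i0) x'); rewrite rhoK; set x := Di _ _ => E.
  exists x; have := psiK (inr (\pi_(Vtheta P') (rho i0, gact (U i0) x'))).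
  rewrite E phiV => -[/(pi_theta_inj regP')]; rewrite /delta => ->.
  by rewrite -gactM mulVg gact1.
have delta_act g x : delta (gact g x) = gact (gamma g) (delta x).
  by rewrite {1}/delta DE -gactM mulKg.
clearbody delta.
exists (@RepEquiv R R' delta gamma delta_bij gamma_bij delta_act gammaM).
exists sigma, rho, V, U; split; [by exists sigmai|by exists rhoi|move=> l s].
case Px: (P l s) => [x|g].
  have [x' -> /(_ i0 1)] := prodX l s x Px.
  rewrite gact1 D1 fE gamma1 mulg1 => /(congr1 (gact (U i0)^-1)).
  by rewrite -!gactM mulKg mulVg gact1 => /= ->.
by have [g' Pg' _] := prodG l s g Px; rewrite Pg' /= (gammaP _ _ _ _ Px Pg').
Qed.

(** * Recovering the action, and the three equivalences *)

Lemma Lmul_inr (R : groupRep) m n (P : 'M[entry R]_(m, n)) (s : Lset P) c :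
  Lmul s (inr c) = inr (Lact s c).
Proof. by case: s. Qed.

(** The constants are a copy of the points, and acting on a point is left multiplication of a
    constant. Hence [phi] restricted to constants is the required bijection on points. *)
Lemma iso_rep_equivalent (R R' : groupRep) m n m' n'
    (P : 'M[entry R]_(m, n)) (P' : 'M[entry R']_(m', n')) :
  (0 < m)%N -> (0 < n)%N -> (0 < m')%N -> (0 < n')%N ->
  regular_mx P -> regular_mx P' ->
  semigroup_isomorphic (Lsemigroup P) (Lsemigroup P') -> rep_equivalent (Lrep P) (Lrep P').
Proof.
move=> m_gt0 n_gt0 m'_gt0 n'_gt0 regP regP' [phi [psi phiK psiK] phiM].
have phiL (s t : Lset P) : phi (Lmul s t) = Lmul (phi s) (phi t) by apply: phiM.
have psiL s t : psi (Lmul s t) = Lmul (psi s) (psi t).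
  by rewrite -{1}(psiK s) -{1}(psiK t) -phiL phiK.
have phi_inr (c : Vtheta P) : exists c', phi (inr c) == inr c' :> Lset P'.
  have [rho [sigma [f [D [_ phiV]]]]] :=
    iso_coordinatesP phiK psiK phiL regP regP' m_gt0 n_gt0 m'_gt0 n'_gt0.
  by elim/quotW: c => -[r x]; rewrite phiV; exists (\pi_(Vtheta P') (rho r, D r x)).
have psi_inr (c : Vtheta P') : exists c', psi (inr c) == inr c' :> Lset P.
  have [rho [sigma [f [D [_ psiV]]]]] :=
    iso_coordinatesP psiK phiK psiL regP' regP m'_gt0 n'_gt0 m_gt0 n_gt0.
  by elim/quotW: c => -[r x]; rewrite psiV; exists (\pi_(Vtheta P) (rho r, D r x)).
pose pt c := xchoose (phi_inr c); pose tp c := xchoose (psi_inr c).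
have ptE c : phi (inr c) = inr (pt c) by apply/eqP/(xchooseP (phi_inr c)).
have tpE c : psi (inr c) = inr (tp c) by apply/eqP/(xchooseP (psi_inr c)).
have pt_bij : bijective pt.
  exists tp => c.
    by have := phiK (inr c); rewrite ptE tpE => -[].
  by have := psiK (inr c); rewrite tpE ptE => -[].
have pt_act (s : Lset P) c : pt (Lact s c) = Lact (phi s) (pt c).
  have := ptE (Lact s c); rewrite -Lmul_inr phiL ptE Lmul_inr.
  by case.
have phi_bij : bijective phi by exists psi.
by split; apply: (@RepEquiv (Lrep P) (Lrep P') pt phi pt_bij phi_bij pt_act phiM).
Qed.

Theorem proposition1p9 (R R' : groupRep) (m n m' n' : nat)
    (P : 'M[entry R]_(m, n)) (P' : 'M[entry R']_(m', n'))
    (m_gt0 : (0 < m)%N) (n_gt0 : (0 < n)%N)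
    (m'_gt0 : (0 < m')%N) (n'_gt0 : (0 < n')%N)
    (faithR : faithful_rep R) (faithR' : faithful_rep R')
    (regP : regular_mx P) (redP : reductive_mx P) (regP' : regular_mx P') :
  [<-> semigroup_isomorphic (Lsemigroup P) (Lsemigroup P');
       rep_equivalent (Lrep P) (Lrep P');
       exists (em : m = m') (en : n = n')
              (A : 'M[option (ggrp R)]_m) (B : 'M[option (ggrp R)]_n)
              (beta : repEquiv R R'),
         [/\ permutational A, permutational B &
             mx0_of_ramified P' =
             castmx (em, en)
               (map_mx (omap (entry_map beta))
                  (mx0_of_group A **m mx0_of_ramified P **m mx0_of_group B))]].
Proof.
have matrixE : matrix_equiv P P' <-> exists (em : m = m') (en : n = n')
    (A : 'M[option (ggrp R)]_m) (B : 'M[option (ggrp R)]_n) (beta : repEquiv R R'),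
    [/\ permutational A, permutational B & mx0_of_ramified P' = castmx (em, en)
      (map_mx (omap (entry_map beta))
        (mx0_of_group A **m mx0_of_ramified P **m mx0_of_group B))].
  split=> [PP'|[em [en PP']]]; last first.
    (* Once [m'] and [n'] are replaced by [m] and [n], [castmx] computes away. *)
    by case: _ / em en P' {regP' m'_gt0} PP' => en; case: _ / en => P' PP'; apply/matrix_equivP.
  have [_ [sigma [rho [_ [_ [sigma_bij rho_bij _]]]]]] := PP'.
  have em : m = m' by have := bij_eq_card sigma_bij; rewrite !card_ord.
  have en : n = n' by have := bij_eq_card rho_bij; rewrite !card_ord.
  exists em, en; case: _ / em en P' {regP' sigma_bij sigma m'_gt0} PP' => en.
  by case: _ / en => P' /matrix_equivP.
have equiv_iso : rep_equivalent (Lrep P) (Lrep P') ->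
    semigroup_isomorphic (Lsemigroup P) (Lsemigroup P').
  by case=> e; exists (equiv_sg e); [apply: (equiv_sg_bij e)|apply: (equiv_mul e)].
tfae.
- exact: iso_rep_equivalent.
(* The second condition yields the third through the first, by forgetting the points. *)
- by move=> /equiv_iso iso; apply/matrixE; apply: iso_matrix_equiv.
- by move=> /matrixE; apply: matrix_equiv_iso.
Qed.
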